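(* For every compact Hausdorff space $X$ one has $\dim X \le \operatorname{Dg} X$, where $\dim$ denotes the covering dimension and $\operatorname{Dg}$ denotes Brouwer's Dimensionsgrad.
   Context: Covering dimension: for a normal space $X$, $\dim X\le n$ means that every finite open cover of $X$ has an (open) refinement of order at most $n+1$, i.e., no point of $X$ is in more than $n+1$ members of the refinement. $\dim X$ is the minimum $n$ for which this holds, or $\infty$ if there is no such $n$. Cut: a continuum is a compact connected Hausdorff space. If $A$ and $B$ are disjoint closed subsets of a space $X$, a cut between $A$ and $B$ in $X$ is a closed set $C\subseteq X$ that meets every continuum $K\subseteq X$ with $K\cap A\neq\emptyset$ and $K\cap B\neq\emptyset$. Dimensionsgrad: defined by recursion. $\operatorname{Dg} X\le -1$ if and only if $X=\emptyset$. For an integer $n\ge 0$, $\operatorname{Dg} X\le n$ means that between every two disjoint closed sets $A$ and $B$ in $X$ there is a cut $C$ in $X$ with $\operatorname{Dg} C\le n-1$ (where $C$ carries the subspace topology). $\operatorname{Dg} X$ is the minimum $n$ with $\operatorname{Dg} X\le n$, or $\infty$ if there is no such $n$. *)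

(* Defs.v *)
From HB Require Import structures.
From mathcomp Require Import all_boot all_order all_algebra.
From mathcomp Require Import all_classical constructive_ereal topology.

Set Implicit Arguments.
Unset Strict Implicit.
Unset Printing Implicit Defensive.

Local Open Scope classical_set_scope.
Local Open Scope card_scope.
Local Open Scope ring_scope.

(* Dimensions take their values in {-1, 0, 1, ...} together with infinity,
   rendered as elements of \bar int.  The bounds are indexed by k = n + 1 in
   nat, so that "_lt k" reads "the dimension is < k", i.e. "<= n" with
   n = k - 1 >= -1. *)

(* The least n >= -1 such that P (n + 1), and +oo if there is none. *)
Definition least_dim (P : nat -> Prop) : \bar int :=
  match pselect (exists k, `[< P k >]) with
  | left exP => ((ex_minn exP)%:Z - 1)%:E
  | right _ => +oo%E
  end.

Definition open_cover (X : topologicalType) (U : set (set X)) : Prop :=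
  (forall O, U O -> open O) /\ \bigcup_(O in U) O = [set: X].

Definition refines (X : Type) (V U : set (set X)) : Prop :=
  forall W, V W -> exists2 O, U O & W `<=` O.

(* No point lies in more than k members of V. *)
Definition order_at_most (X : Type) (k : nat) (V : set (set X)) : Prop :=
  forall x : X, [set W | V W /\ W x] #<= `I_k.

Definition covering_dim_lt (k : nat) (X : topologicalType) : Prop :=
  forall U : set (set X), finite_set U -> open_cover U ->
    exists V : set (set X),
      [/\ open_cover V, refines V U & order_at_most k V].

Definition covering_dim (X : topologicalType) : \bar int :=
  least_dim (fun k => covering_dim_lt k X).

Definition continuum (X : topologicalType) (K : set X) : Prop :=
  [/\ compact K, connected K & hausdorff_space (set_type K)].

Definition cut_between (X : topologicalType) (A B C : set X) : Prop :=
  closed C /\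
  forall K : set X, continuum K ->
    K `&` A !=set0 -> K `&` B !=set0 -> K `&` C !=set0.

(* set_type C is C with the subspace topology. *)
Fixpoint Dimensionsgrad_lt (k : nat) (X : topologicalType) : Prop :=
  if k is k'.+1 then
    forall A B : set X, closed A -> closed B -> A `&` B = set0 ->
      exists2 C : set X, cut_between A B C & Dimensionsgrad_lt k' (set_type C)
  else [set: X] = set0.

Definition Dimensionsgrad (X : topologicalType) : \bar int :=
  least_dim (fun k => Dimensionsgrad_lt k X).

(* Main.v *)
Require Import Defs.
From HB Require Import structures.
From mathcomp Require Import all_boot all_order all_algebra.
From mathcomp Require Import all_classical constructive_ereal topology.

(* Induction on the dimension.  Shrink an open cover U to a closed cover F, and
   let C_i be a low-dimensional cut between F_i and the complement of U_i.  By
   the sum theorem the union of the cuts has a neighbourhood G carrying a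
   refinement of U of order at most k.  Quasi-components of the compact set
   X \ G are continua missing C_i, so X \ G splits into two relatively clopen
   pieces, one containing F_i \ G and the other containing the points outside
   U_i and G.  Disjointifying the first pieces over i yields pairwise
   disjoint open sets D_i inside U_i that cover X \ G, so adding them raises the
   order by at most one. *)

Set Implicit Arguments.
Unset Strict Implicit.
Unset Printing Implicit Defensive.

Local Open Scope classical_set_scope.
Local Open Scope card_scope.

(** * Compactness, separation and quasi-components *)

Lemma compact_directed_subset (X : topologicalType) (F : set (set X))
    (O : set X) :
  compact [set: X] -> open O -> F !=set0 ->
  (forall E, F E -> closed E) ->
  (forall E E', F E -> F E' -> F (E `&` E')) ->
  \bigcap_(E in F) E `<=` O -> exists2 E, F E & E `<=` O.
Proof.
move=> cX oO [E0 FE0] clF FI capO; apply: contrapT => nE.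
have meetO E : F E -> E `&` ~` O !=set0.
  move=> FE; apply: contrapT => /set0P/negP/negPn/eqP/disjoints_subset.
  by rewrite setCK => EO; apply: nE; exists E.
(* If no [E] fits inside [O], the sets [E \ O] generate a proper filter; a cluster point of it lies
   in every [E] but outside [O]. *)
pose G := filter_from F (fun E => E `&` ~` O).
have GF : Filter G.
  apply: filter_from_filter; first by exists E0.
  move=> E E' FE FE'; exists (E `&` E'); first exact: FI.
  by move=> x [[? ?] ?].
have GP : ProperFilter G by apply: filter_from_proper.
have [x [_ Gx]] := cX G GP filterT.
have clx E : F E -> (E `&` ~` O) x.
  move=> FE; have : closed (E `&` ~` O).
    by apply: closedI; [exact: clF|exact: open_closedC].
  by apply => B Bx; apply: Gx => //; exists E.
by have [_] := clx _ FE0; apply; apply: capO => E /clx[].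
Qed.

Lemma compact_hausdorff_separation (X : topologicalType) (A B : set X) :
  compact [set: X] -> hausdorff_space X ->
  closed A -> closed B -> A `&` B = set0 ->
  exists U V, [/\ open U, open V, A `<=` U, B `<=` V & U `&` V = set0].
Proof.
move=> cX hX clA clB AB0.
have [] := @compact_normal X hX cX A clA (~` B).
  apply/set_nbhsP; exists (~` B); split => //; first exact: closed_openC.
  exact/disjoints_subset.
move=> C /set_nbhsP[W [oW AW WC]] CB; exists W, (~` closure C); split => //.
- exact/closed_openC/closed_closure.
- by apply: subsetCr => x /CB.
- by apply/disjoints_subset; rewrite setCK => x /WC /subset_closure.
Qed.

Lemma set_type_compact (X : topologicalType) (C : set X) :
  compact C -> compact [set: set_type C].
Proof.
move=> cC F FF _.
have FP : ProperFilter (set_val @ F) by exact: fmap_proper_filter.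
have FC : (set_val @ F) C.
  by rewrite /fmap /=; apply: filterS filterT => -[x /= xC] _; exact/set_mem.
have [x [Cx Fx]] := cC _ FP FC.
exists (SigSub (mem_set Cx)); split => // A B FA.
rewrite nbhsE => -[_ [[W oW <-] Wx] WB].
have [] := Fx (set_val @` A) W.
- by rewrite /fmap /=; apply: filterS FA => y Ay; exists y.
- exact: open_nbhs_nbhs.
- by move=> _ [[y Ay <-] Wy]; exists y; split => //; exact: WB.
Qed.

Lemma set_type_hausdorff (X : topologicalType) (C : set X) :
  hausdorff_space X -> hausdorff_space (set_type C).
Proof.
move=> hX p q pq; apply: val_inj; apply: hX => A B Ap Bq.
have cont := @initial_continuous (set_type C) X set_val.
by have [z [Az Bz]] := pq _ _ (cont p _ Ap) (cont q _ Bq); exists (set_val z).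
Qed.

(** This intersection [Q] is the quasi-component of [a] in [Y]. If [Q] splits into disjoint closed
    [P] and [R] with [a] in [P], separate them by open [U] and [V]. By compactness some relatively
    clopen [E] containing [a] lies in [U] and [V] together; then [E \ V] is again one of the
    intersected sets, so [Q] misses [R]. *)
Lemma quasi_component_connected (X : topologicalType) (Y : set X) (a : X) :
  compact [set: X] -> hausdorff_space X -> closed Y -> Y a ->
  connected
    (\bigcap_(E in [set E | [/\ closed E, E `<=` Y,
                               closed (Y `\` E) & E a]]) E).
Proof.
move=> cX hX clY Ya.
set F := [set E | _]; set Q := \bigcap_(E in F) E.
have FY : F Y by split => //; rewrite setDv; exact: closed0.
have clF E : F E -> closed E by case.
have clQ : closed Q by apply: closed_bigI.
have FI E E' : F E -> F E' -> F (E `&` E').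
  move=> [cE EY cE' Ea] [cD DY cD' Da]; split => //; first exact: closedI.
    by move=> x [/EY].
  by rewrite setDIr; exact: closedU.
have key P R : closed P -> closed R -> P `&` R = set0 -> P `|` R = Q ->
    P a -> R = set0.
  move=> cP cR PR0 PRQ Pa.
  have [U [V [oU oV PU RV UV0]]] :=
    compact_hausdorff_separation cX hX cP cR PR0.
  have [|E FE EUV] := compact_directed_subset (O := U `|` V) cX (openU oU oV)
    (ex_intro _ _ FY) clF FI.
    by rewrite -/Q -PRQ; exact: setUSS.
  have [cE EY cYE Ea] := FE.
  have FEV : F (E `\` V).
    split.
    - by rewrite setDE; apply: closedI => //; exact: open_closedC.
    - by move=> x [/EY].
    (* Inside [E], lying in [V] is the same as lying outside [U], which turns this complement into a
       closed set. *)
    - have -> : Y `\` (E `\` V) = (Y `\` E) `|` (E `\` U).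
        apply/seteqP; split => [x [Yx nEV]|x [[Yx nEx]|[Ex nUx]]].
        + have [Ex|nEx] := pselect (E x); last by left.
          right; split => // Ux; apply: nEV; split => // Vx.
          by have : (U `&` V) x by []; rewrite UV0.
        + by split => // -[].
        + split; first exact: EY.
          by move=> [_ nVx]; have [] := EUV _ Ex.
      apply: closedU => //; rewrite setDE; apply: closedI => //.
      exact: open_closedC.
    - split => // Va; have : (U `&` V) a by split => //; exact: PU.
      by rewrite UV0.
  apply/seteqP; split => // x Rx.
  have : Q x by rewrite -PRQ; right.
  by move=> /(_ _ FEV)[_]; apply; exact: RV.
(* Here [B] is nonempty and relatively clopen in [Q]. Whichever of [B] and [Q \ B] contains [a]
   serves as [P], and the other one is empty. *)
move=> B [b Bb] [O oO BO] [D cD BD].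
have clB : closed B by rewrite BD; exact: closedI.
have QBE : Q `\` B = Q `&` ~` O.
  by rewrite BO setDIr setDv set0U.
have clQB : closed (Q `\` B).
  by rewrite QBE; apply: closedI => //; exact: open_closedC.
have BQ : B `<=` Q by rewrite BO; exact: subIsetl.
have [Ba|nBa] := pselect (B a).
  have QB0 : Q `\` B = set0.
    apply: (key B) => //; first by rewrite setDIK.
    by rewrite setDUK.
  by apply/seteqP; split => //; rewrite -setD_eq0.
have B0 : B = set0.
  apply: (key (Q `\` B)) => //; first by rewrite setIC setDIK.
    by rewrite setUC setDUK.
  by split => // E [].
by move: Bb; rewrite B0.
Qed.

(** Compactness is used twice: first to find, around each point of [B] outside [G], a relatively
    clopen piece of [~ G] missing [A]; then to find one clopen piece that contains [A \ G] and
    misses all of [B]. *)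
Lemma cut_neighborhood_separates (X : topologicalType) (A B C G : set X) :
  compact [set: X] -> hausdorff_space X -> closed A -> closed B ->
  cut_between A B C -> open G -> C `<=` G ->
  exists O P, [/\ open O, open P, O `&` P = set0, O `&` B = set0 &
    [/\ A `<=` G `|` O & ~` G `<=` O `|` P]].
Proof.
move=> cX hX clA clB [clC cutC] oG CG.
have clY : closed (~` G) by exact: open_closedC.
pose clopen E := [/\ closed E, E `<=` ~` G & closed (~` G `\` E)].
have clopenI E E' : clopen E -> clopen E' -> clopen (E `&` E').
  move=> [cE EY cE'] [cD DY cD']; split => //; first exact: closedI.
    by move=> x [/EY].
  by rewrite setDIr; exact: closedU.
have clopenY : clopen (~` G) by split => //; rewrite setDv; exact: closed0.
have clopenC E : clopen E -> clopen (~` G `\` E).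
  by move=> [cE EY cE']; split => //; rewrite setDD setIC; apply: closedI.
have pointwise b : B b -> ~ G b -> exists2 E, clopen E /\ E b & E `<=` ~` A.
  move=> Bb Gb.
  pose F := [set E | [/\ closed E, E `<=` ~` G, closed (~` G `\` E) & E b]].
  have FE E : clopen E /\ E b <-> F E by split => [[[]]|[]].
  have conn := quasi_component_connected cX hX clY Gb.
  rewrite -/F in conn.
  have clQ : closed (\bigcap_(E in F) E) by apply: closed_bigI => E [].
  have [|||||E /FE] := compact_directed_subset (F := F) (O := ~` A) cX.
  - exact: closed_openC.
  - by exists (~` G); apply/FE.
  - by move=> E [].
  - by move=> E E' /FE[? ?] /FE[? ?]; apply/FE; split => //; exact: clopenI.
  (* A quasi-component meeting both [A] and [B] would be a continuum that misses the cut, since it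
     avoids [G]. *)
  - move=> x Qx Ax.
    have [] := cutC (\bigcap_(E in F) E).
    + split => //; last exact: set_type_hausdorff.
      exact: subclosed_compact cX _.
    + by exists x.
    + by exists b; split => // E [].
    + by move=> y [Qy /CG]; apply: (Qy (~` G)); apply/FE.
  - by exists E.
have [E [clE AE] EB] : exists2 E, clopen E /\ A `\` G `<=` E & E `<=` ~` B.
  apply: (compact_directed_subset (F := [set E | clopen E /\ A `\` G `<=` E])).
  - exact: cX.
  - exact: closed_openC.
  - by exists (~` G); split => // x [].
  - by move=> E [[]].
  - move=> E E' [? AE] [? AE']; split; first exact: clopenI.
    by move=> x Ax; split; [exact: AE|exact: AE'].
  - move=> x Qx Bx.
    have Gx : ~ G x by apply: (Qx (~` G)); split => // y [].
    have [E [clE Ex] EA] := pointwise x Bx Gx.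
    (* The complement in [~ G] of the clopen piece around [x] still contains [A \ G], but not
       [x]. *)
    have [|_] := Qx (~` G `\` E); last by apply.
    split; first exact: clopenC.
    by move=> y [Ay Gy]; split => // /EA.
have [cE EY cYE] := clE.
have [O [P [oO oP EO FP OP0]]] :=
  compact_hausdorff_separation cX hX cE cYE (setDIK _ _).
exists (O `&` ~` B), P; split => //.
- by apply: openI => //; exact: closed_openC.
- by rewrite setIAC OP0 set0I.
- by rewrite -setIA setICl setI0.
- split.
    move=> x Ax; have [Gx|Gx] := pselect (G x); [by left|right].
    have Ex : E x by exact: AE.
    by split; [exact: EO|exact: EB].
  move=> x Gx; have [Ex|Ex] := pselect (E x); [left|by right; exact: FP].
  by split; [exact: EO|exact: EB].
Qed.

(** * Multiplicity of finite indexed families *)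

Definition multiplicity (I : finType) (X : Type) (V : I -> set X) (x : X) :
  nat :=
  #|[pred i | `[< V i x >]]|.

Lemma multiplicity_le (I : finType) (X Y : Type) (V : I -> set X)
    (W : I -> set Y) (x : X) (y : Y) :
  (forall i, V i x -> W i y) -> (multiplicity V x <= multiplicity W y)%N.
Proof.
move=> VW; apply/subset_leq_card/fintype.subsetP => i.
by rewrite !unfold_in => /asboolP/VW/asboolP.
Qed.

Lemma multiplicity_leP (I : finType) (X : Type) (V : I -> set X) (x : X) k :
  [set i | V i x] #<= `I_k <-> (multiplicity V x <= k)%N.
Proof.
set A := [pred i | `[< V i x >]].
split => [/pcard_leP[f]|le_k].
  have sub : {subset [seq f i | i <- enum A] <= iota 0 k}.
    move=> _ /mapP[i iA ->]; rewrite mem_iota add0n /=.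
    by have := @funS _ _ _ _ f i; apply; move: iA; rewrite mem_enum => /asboolP.
  have uf : uniq [seq f i | i <- enum A].
    rewrite map_inj_in_uniq ?enum_uniq // => i j iA jA.
    by apply: (@inj _ _ _ f); rewrite inE /=; apply/asboolP;
      [move: iA|move: jA]; rewrite mem_enum.
  by have := uniq_leq_size uf sub; rewrite size_map size_iota -cardE.
apply/pcard_leP/injfunPex; exists (fun i => index i (enum A)) => [i|i j] /=.
  move=> Vi; apply: leq_trans le_k; rewrite /multiplicity cardE index_mem.
  by rewrite mem_enum; apply/asboolP.
rewrite !inE /= => Vi Vj; apply: index_inj => //;
  by rewrite mem_enum; apply/asboolP.
Qed.

(** Multiplicity counts indices and order counts distinct sets; sets that coincide for several
    indices only lower the order. *)
Lemma range_order_at_most (I : finType) (X : Type) (V : I -> set X) k :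
  (forall x, (multiplicity V x <= k)%N) -> order_at_most k (range V).
Proof.
move=> multV x; apply: (@card_le_trans _ _ _ (V @` [set i | V i x])).
  by apply: subset_card_le => W [[i _ <-] Vx]; exists i.
apply: card_le_trans (card_image_le _ _) _.
exact/multiplicity_leP.
Qed.

(** * Shrinkings of open covers *)

Definition indexed_open_cover (I : Type) (X : topologicalType)
    (U : I -> set X) : Prop :=
  (forall i, open (U i)) /\ (forall x, exists i, U i x).

(** Assign to each member of a refinement an index of a set of [U] containing it, and unite the
    members with equal index. The indices active at [x] are then values of the assignment on members
    through [x], so there are at most [k]. *)
Lemma covering_dim_lt_shrinking (k : nat) (X : topologicalType) (I : finType)
    (U : I -> set X) :
  covering_dim_lt k X -> indexed_open_cover U ->
  exists W : I -> set X, [/\ indexed_open_cover W, forall i, W i `<=` U i &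
    forall x, (multiplicity W x <= k)%N].
Proof.
move=> dimX [oU covU].
have [||V [[oV covV] VU ordV]] := dimX (range U).
- exact: finite_image.
- split => [_ [i _ <-]//|]; apply/seteqP; split => // x _.
  by have [i Ux] := covU x; exists (U i).
have /choice[h hP] (O : set X) : exists o : option I,
    V O -> if o is Some i then O `<=` U i else False.
  have [/VU[_ [i _ <-] OU]|nVO] := pselect (V O); last by exists None.
  by exists (Some i).
exists (fun i => \bigcup_(O in [set O | V O /\ h O = Some i]) O); split.
- split => [i|x].
    by apply: bigcup_open => O [/oV].
  have [O VO Ox] : (\bigcup_(O in V) O) x by rewrite covV.
  have := hP _ VO; case hO : (h O) => [i|//] _.
  by exists i, O.
- by move=> i x [O [VO hO] Ox]; have := hP _ VO; rewrite hO; apply.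
- move=> x; apply/multiplicity_leP.
  have : [set h O | O in [set O | V O /\ O x]] #<= `I_k.
    exact: card_le_trans (card_image_le _ _) (ordV x).
  apply: card_le_trans.
  apply: (@card_le_trans _ _ _ (Some @` [set i |
    (\bigcup_(O in [set O | V O /\ h O = Some i]) O) x])).
    by rewrite card_le_some card_lexx.
  by apply: subset_card_le => _ [i [O [VO hO] Ox] <-]; exists O.
Qed.

Lemma closed_subspace_shrinking (k : nat) (X : topologicalType) (C : set X)
    (I : finType) (U : I -> set X) :
  closed C -> covering_dim_lt k (set_type C) -> indexed_open_cover U ->
  exists V : I -> set X, [/\ indexed_open_cover V, forall i, V i `<=` U i &
    forall x, C x -> (multiplicity V x <= k)%N].
Proof.
move=> clC dimC [oU covU].
have [|W [[oW covW] WU multW]] := @covering_dim_lt_shrinking k (set_type C) I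
  (fun i => set_val @^-1` U i) dimC.
  split => [i|x]; last exact: covU.
  by exists (U i).
have /choice[O OP] i : exists O : set X, open O /\ set_val @^-1` O = W i.
  by have [O oO <-] := oW i; exists O.
(* Adding [~ C] keeps the cover intact off [C] and changes nothing on [C]. *)
exists (fun i => U i `&` (O i `|` ~` C)); split.
- split => [i|x].
    apply: openI => //; apply: openU; first by case: (OP i).
    exact: closed_openC.
  have [Cx|nCx] := pselect (C x); last first.
    by have [i Ux] := covU x; exists i; split => //; right.
  have [i Wx] := covW (SigSub (mem_set Cx)).
  exists i; split; first exact: (WU _ _ Wx).
  by left; move: Wx; rewrite -(OP i).2.
- by move=> i x [].
- move=> x Cx; apply: leq_trans (multW (SigSub (mem_set Cx))).
  by apply: multiplicity_le => i [Ux [Ox|//]]; rewrite -(OP i).2.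
Qed.

(* The finite sum theorem for covering dimension, in the form of a shrinking:
   refining again for the next closed set does not spoil the earlier bounds. *)
Lemma finite_closed_family_shrinking (k : nat) (X : topologicalType)
    (I J : finType) (C : J -> set X) (U : I -> set X) :
  (forall j, closed (C j)) -> (forall j, covering_dim_lt k (set_type (C j))) ->
  indexed_open_cover U ->
  exists V : I -> set X, [/\ indexed_open_cover V, forall i, V i `<=` U i &
    forall j x, C j x -> (multiplicity V x <= k)%N].
Proof.
move=> clC dimC covU.
suff [V [covV VU multV]] : exists V : I -> set X,
    [/\ indexed_open_cover V, forall i, V i `<=` U i &
      forall j x, j \in enum J -> C j x -> (multiplicity V x <= k)%N].
  exists V; split => // j x; apply: (multV j); exact: mem_enum.
elim: (enum J) => [|j s [V [covV VU multV]]].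
  by exists U; split => // i.
have [W [covW WV multW]] := closed_subspace_shrinking (clC j) (dimC j) covV.
exists W; split => // [i|i x]; first exact: subset_trans (WV i) (VU i).
rewrite inE => /predU1P[->|si] Cx; first exact: multW.
by apply: leq_trans (multV _ _ si Cx); apply: multiplicity_le => l; exact: WV.
Qed.

Lemma closure_shrinking (X : topologicalType) (I : finType) (U : I -> set X) :
  compact [set: X] -> hausdorff_space X -> indexed_open_cover U ->
  exists V : I -> set X, indexed_open_cover V /\
    forall i, closure (V i) `<=` U i.
Proof.
move=> cX hX covU.
suff [V [covV VU clVU]] : exists V : I -> set X,
    [/\ indexed_open_cover V, forall i, V i `<=` U i &
      forall i, i \in enum I -> closure (V i) `<=` U i].
  by exists V; split => // i; apply: clVU; rewrite mem_enum.
elim: (enum I) => [|j s [V [[oV covV] VU clVU]]].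
  by exists U; split => // i.
(* The points outside [R] are covered by [V j] alone, so the closed set [~ R] can be separated from
   [~ V j], and [O] can replace [V j]. *)
pose R := \bigcup_(i in [set i | i != j]) V i.
have oR : open R by exact: bigcup_open.
have [||| O [P [oO oP RO VP OP0]]] :=
    @compact_hausdorff_separation X (~` R) (~` V j) cX hX.
- exact: open_closedC.
- exact: open_closedC.
- rewrite -setCU -setCT; congr (~` _); apply/seteqP; split => // x _.
  have [i Vx] := covV x; have [<-|/eqP ij] := pselect (i = j); first by right.
  by left; exists i.
have clOV : closure O `<=` V j.
  have : closure O `<=` ~` P.
    have -> : ~` P = closure (~` P) by apply/closure_id/open_closedC.
    by apply: closureS; exact/disjoints_subset.
  by move=> OP x /OP nPx; apply: contrapT => /VP.
pose W i := if i == j then O else V i.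
have WV i : W i `<=` V i.
  rewrite /W; case: eqP => [->|_]; last exact: subset_refl.
  exact: subset_trans (@subset_closure _ _) clOV.
exists W; split.
- split => [i|x]; first by rewrite /W; case: ifP.
  have [[i /= ij Vx]|nRx] := pselect (R x).
    by exists i; rewrite /W (negbTE ij).
  by exists j; rewrite /W eqxx; exact: RO.
- by move=> i; exact: subset_trans (WV i) (VU i).
- move=> i; rewrite inE => /predU1P[->|si].
    by rewrite /W eqxx; exact: subset_trans clOV (VU j).
  exact: subset_trans (closureS (WV i)) (clVU _ si).
Qed.

(** Multiplicity of a finite closed family is upper semicontinuous: points near [x] avoid each of
    the finitely many members that [x] avoids. *)
Lemma open_multiplicity_le (X : topologicalType) (I : finType)
    (F : I -> set X) k :
  (forall i, closed (F i)) -> open [set x | (multiplicity F x <= k)%N].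
Proof.
move=> clF; rewrite openE => x /= multx.
have : \forall y \near x, forall i, F i y -> F i x.
  apply: filter_forall => i; have [Fx|nFx] := pselect (F i x).
    by apply: filterS filterT.
  have : nbhs x (~` F i).
    by apply: open_nbhs_nbhs; split => //; exact: closed_openC.
  by apply: filterS => y.
apply: filterS => y Fyx; apply: leq_trans multx; exact: multiplicity_le.
Qed.

Lemma multiplicity_sum_disjoint (X : Type) (I J : finType) (V : I -> set X)
    (D : J -> set X) x k :
  (multiplicity V x <= k)%N ->
  (forall i j, D i x -> D j x -> i = j) ->
  (multiplicity (fun s : I + J =>
    match s with inl i => V i | inr j => D j end) x <= k.+1)%N.
Proof.
move=> multV disj; rewrite /multiplicity -sum1_card big_sumType /= -(addn1 k).
rewrite !sum1_card; apply: leq_add; first exact: multV.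
apply/card_le1P => i; rewrite unfold_in => /asboolP Di j.
rewrite !unfold_in /=; apply/asboolP/eqP => [Dj|->//]; exact: disj.
Qed.

(** * The inductive step: from cuts to a refinement *)

Lemma covering_dim_lt_cuts (k n : nat) (X : topologicalType)
    (U : 'I_n -> set X) :
  compact [set: X] -> hausdorff_space X ->
  (forall A B : set X, closed A -> closed B -> A `&` B = set0 ->
    exists2 C, cut_between A B C & covering_dim_lt k (set_type C)) ->
  indexed_open_cover U ->
  exists W : 'I_n + 'I_n -> set X, [/\ indexed_open_cover W,
    forall s, exists i, W s `<=` U i &
    forall x, (multiplicity W x <= k.+1)%N].
Proof.
move=> cX hX cuts covU; have [oU _] := covU.
have [F [[_ covF] clFU]] := closure_shrinking cX hX covU.
have /choice[C CP] (i : 'I_n) : exists C,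
    cut_between (closure (F i)) (~` U i) C /\ covering_dim_lt k (set_type C).
  have [||| C cutC dimC] := cuts (closure (F i)) (~` U i).
  - exact: closed_closure.
  - exact: open_closedC.
  - by apply/disjoints_subset; rewrite setCK.
  - by exists C.
have [|| V [covV VU multV]] :=
  @finite_closed_family_shrinking k X 'I_n 'I_n C U _ _ covU.
- by move=> i; case: (CP i) => -[].
- by move=> i; case: (CP i).
have [V' [[oV' covV'] clV'V]] := closure_shrinking cX hX covV.
pose G := [set x | (multiplicity (fun i => closure (V' i)) x <= k)%N].
have oG : open G by apply: open_multiplicity_le => i; exact: closed_closure.
have CG i : C i `<=` G.
  move=> x Cx; apply: leq_trans (multV _ _ Cx).
  by apply: multiplicity_le => j; exact: clV'V.
have /choice[OP OPP] i : exists OP : set X * set X,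
    [/\ open OP.1, open OP.2, OP.1 `&` OP.2 = set0, OP.1 `<=` U i &
      closure (F i) `<=` G `|` OP.1 /\ ~` G `<=` OP.1 `|` OP.2].
  have [O [P [oO oP OP0 OU [FO GOP]]]] := cut_neighborhood_separates cX hX
    (@closed_closure _ (F i)) (open_closedC (oU i)) (CP i).1 oG (CG i).
  exists (O, P); split => //=.
  by move/disjoints_subset : OU; rewrite setCK.
(* Requiring the second side for every earlier index makes the [D i] pairwise disjoint, as the two
   sides of each index are disjoint. *)
pose D i := (OP i).1 `&` \bigcap_(j in [set j : 'I_n | (j < i)%N]) (OP j).2.
exists (fun s => match s with inl i => V' i `&` G | inr i => D i end); split.
- split => [[i|i]|x].
  + exact: openI.
  + apply: openI; first by case: (OPP i).
    rewrite -[X in open X]setCK setC_bigcap; apply: closed_openC.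
    apply: closed_bigcup => [|j _]; [exact: finite_finset|apply: open_closedC].
    by case: (OPP j).
  + have [Gx|nGx] := pselect (G x).
      by have [i Vx] := covV' x; exists (inl i).
    have exO : exists i, `[< (OP i).1 x >].
      have [i Fx] := covF x; exists i; apply/asboolP.
      by case: (OPP i) => _ _ _ _ [+ _] => /(_ _ (subset_closure Fx))[].
    have [i0 Oi0] := exO.
    (* Take the least [i] whose first side contains [x]; at each earlier index, [x], being outside
       [G], must lie on the second side. *)
    case: (@arg_minnP _ i0 (fun i => `[< (OP i).1 x >]) val Oi0).
    move=> i /asboolP Oi imin.
    exists (inr i); split => // j /= ji.
    case: (OPP j) => _ _ _ _ [_ /(_ _ nGx)[Oj|//]].
    by have /imin := asboolT Oj; rewrite leqNgt ji.
- move=> [i|i]; exists i.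
    move=> x [V'x _]; apply: VU; apply: clV'V; exact: subset_closure.
  by case: (OPP i) => _ _ _ OU _ x [/OU].
- move=> x; apply: multiplicity_sum_disjoint.
    (* The sets cut down to [G] contribute at most [k] on [G] and nothing off it. *)
    have [Gx|nGx] := pselect (G x).
      apply: leq_trans Gx; apply: multiplicity_le => i [V'x _].
      exact: subset_closure.
    rewrite (_ : multiplicity _ _ = 0%N) //; apply: eq_card0 => i.
    by rewrite !inE; apply/asboolP => -[].
  have lt_absurd i j : D i x -> D j x -> ~ (i < j)%N.
    move=> [Oi _] [_ Pj] ij; case: (OPP i) => _ _ OP0 _ _.
    have : ((OP i).1 `&` (OP i).2) x by split => //; exact: Pj.
    by rewrite OP0.
  move=> i j Di Dj; case: (ltngtP i j) => [ij|ji|/val_inj //].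
    by case: (lt_absurd i j).
  by case: (lt_absurd j i).
Qed.

(** Cuts are closed, hence compact Hausdorff as subspaces, so the induction hypothesis turns their
    Dimensionsgrad bound into a covering bound. At [k = 0] the space is empty and the empty family
    covers it. *)
Lemma Dimensionsgrad_lt_covering_dim_lt (k : nat) (X : topologicalType) :
  compact [set: X] -> hausdorff_space X ->
  Dimensionsgrad_lt k X -> covering_dim_lt k X.
Proof.
elim: k X => [X _ _ X0 U _ _|k IHk X cX hX dgX U /finite_seqP[s ->] [oU covU]].
  exists set0; split => //.
    by split => //; rewrite bigcup_set0 -X0.
  by move=> x; have : [set: X] x by []; rewrite X0.
(* The finite cover is indexed by positions in [s], so the default [set0] of [nth] is never
   reached. *)
have [|| W [[oW covW] WU multW]] :=
  @covering_dim_lt_cuts k (size s) X (fun i => nth set0 s i) cX hX.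
- move=> A B clA clB AB0; have [C cutC dgC] := dgX A B clA clB AB0.
  exists C => //; apply: IHk => //; last exact: set_type_hausdorff.
  by apply: set_type_compact; apply: subclosed_compact cX _ => //; case: cutC.
- split => [i|x]; first by apply: oU; exact: mem_nth.
  have [O /= sO Ox] : (\bigcup_(O in [set` s]) O) x by rewrite covU.
  have ltO : (index O s < size s)%N by rewrite index_mem.
  by exists (Ordinal ltO); rewrite /= nth_index.
exists (range W); split.
- split => [_ [i _ <-]//|]; apply/seteqP; split => // x _.
  by have [i Wx] := covW x; exists (W i).
- move=> _ [i _ <-]; have [j WUj] := WU i; exists (nth set0 s j) => //.
  exact: mem_nth.
- exact: range_order_at_most.
Qed.

(** The least bound valid for [Q] is also valid for [P]; if [Q] has none, the right side is
    infinite. *)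
Lemma least_dim_le (P Q : nat -> Prop) :
  (forall k, Q k -> P k) -> (least_dim P <= least_dim Q)%E.
Proof.
move=> QP; rewrite /least_dim.
case: (pselect (exists k, `[< Q k >])) => [exQ|_]; last exact: leey.
case: pselect => [exP|nexP]; last first.
  by have [k /asboolP/QP Pk] := exQ; case: nexP; exists k; apply/asboolP.
case: (ex_minnP exP) => k _ kmin.
case: (ex_minnP exQ) => m /asboolP/QP/asboolP/kmin km _.
by rewrite lee_fin Num.Theory.lerD2r lez_nat.
Qed.

Theorem mainTheorem1 (X : topologicalType)
    (X_compact : compact [set: X]%classic) (X_hausdorff : hausdorff_space X) :
  (covering_dim X <= Dimensionsgrad X)%E.
Proof.
apply: least_dim_le => k; exact: Dimensionsgrad_lt_covering_dim_lt.
Qed.
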